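(* Let $s$ be a zero-mean Lévy process with finite variance $\sigma_0^2$. Let $\mathrm{MSE}_M^{\rm lin}=\mathbb{E}\big[\|s-\mathrm{P}_M^{\rm lin}(s)\|_{L_2([0,1])}^2\big]$ be the mean-squared error of the linear Haar approximation of $s$ on $[0,1]$. Then for every integer $M\geq 1$, $$\mathrm{MSE}_M^{\rm lin}=\frac{\sigma_0^2}{12}\,\frac{1}{2^J}\left(2-\frac{m}{2^J}\right),$$ where $J=\lfloor\log_2 M\rfloor$ and $m=M-2^J\in\{0,\ldots,2^J-1\}$. In particular, for every $M\in 2^{\mathbb{N}}=\{2^i: i=0,1,2,\ldots\}$, $$\mathrm{MSE}_M^{\rm lin}=\frac{\sigma_0^2}{6M}.$$
   Context: A Lévy process $s$ is a process with independent and stationary increments and $s(0)=0$, equivalently the solution of $\mathrm{D}s=w$, $s(0)=0$, where $\mathrm{D}$ is the weak derivative and $w$ is a Lévy white noise. ''Zero mean with finite variance $\sigma_0^2$'' refers to the noise: $\mathbb{E}[\langle w,\varphi\rangle]=0$ and $\mathbb{E}[\langle w,\varphi\rangle^2]=\sigma_0^2\|\varphi\|_2^2$ for test functions $\varphi$; equivalently, $s(t)$ has mean $0$ and variance $\sigma_0^2 t$ for $t\ge 0$. All processes are restricted to $[0,1]$. Haar basis of $L_2([0,1])$: $\phi=\mathbb{1}_{[0,1]}$, $\psi=\mathbb{1}_{[0,1/2]}-\mathbb{1}_{[1/2,1]}$, $\psi_{j,k}=2^{j/2}\psi(2^j\cdot-k)$ for $j\geq 0$, $0\leq k\leq 2^j-1$.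 The orthonormal basis is $\{\phi\}\cup\{\psi_{j,k}\}_{j\geq 0,\,0\leq k\leq 2^j-1}$, ordered by the index $\mathrm{Ind}(\phi)=0$, $\mathrm{Ind}(\psi_{j,k})=2^j+k$. Linear approximation: for $f\in L_2([0,1])$, $\mathrm{P}_M^{\rm lin}(f)$ is the partial Haar expansion of $f$ obtained by keeping the first $M$ terms, i.e. those of index $0,1,\ldots,M-1$ with respect to $\mathrm{Ind}$. *)

(* Defs.v *)
From HB Require Import structures.
From mathcomp Require Import all_boot all_order all_algebra.
From mathcomp Require Import all_classical all_reals all_analysis.

Set Implicit Arguments.
Unset Strict Implicit.
Unset Printing Implicit Defensive.
Import Order.TTheory GRing.Theory Num.Theory.
Import numFieldNormedType.Exports.

Local Open Scope classical_set_scope.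
Local Open Scope ring_scope.

Section Haar.
Context {R : realType}.

Definition haar_phi : R -> R := \1_(`[0, 1] : set R).

(* The closed halves overlap, so the value at 1/2 is 0. *)
Definition haar_mother (x : R) : R :=
  \1_(`[0, 1 / 2] : set R) x - \1_(`[1 / 2, 1] : set R) x.

Definition haar_psi (j k : nat) (x : R) : R :=
  2 `^ (j%:R / 2) * haar_mother (2 ^+ j * x - k%:R).

(* The Haar basis listed along Ind(phi) = 0, Ind(psi_{j,k}) = 2^j + k. *)
Definition haar (n : nat) : R -> R :=
  if n == 0%N then haar_phi
  else let j := trunc_log 2 n in haar_psi j (n - 2 ^ j)%N.

Lemma haar_Ind (j k : nat) : (k < 2 ^ j)%N -> haar (2 ^ j + k) = haar_psi j k.
Proof.
move=> kj; rewrite /haar addn_eq0 expn_eq0 /=.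
have -> : trunc_log 2 (2 ^ j + k) = j.
  by apply: trunc_log_eq => //; rewrite leq_addr /= expnS mul2n -addnn ltn_add2l.
by rewrite addKn.
Qed.

Definition haar_coef (f : R -> R) (n : nat) : R :=
  \int[lebesgue_measure]_(t in `[0, 1]) (f t * haar n t).

Definition haar_lin_approx (M : nat) (f : R -> R) (t : R) : R :=
  \sum_(n < M) haar_coef f n * haar n t.

Definition sq_norm_L2 (f : R -> R) : \bar R :=
  (\int[lebesgue_measure]_(t in `[0%R, 1%R]) ((f t) ^+ 2)%:E)%E.

End Haar.

Section Levy.
Context {d : measure_display} {T : measurableType d} {R : realType}.
Variable P : probability T R.

(* As the B i may be setT, this entails the product rule for subfamilies. *)
Definition independent_RVs (n : nat) (X : 'I_n -> T -> R) : Prop :=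
  forall B : 'I_n -> set R, (forall i, measurable (B i)) ->
    P (\bigcap_(i in [set: 'I_n]) (X i @^-1` B i)) =
    (\prod_(i < n) P (X i @^-1` B i))%E.

(* The time set is [0, +oo[; the values of s at negative times are irrelevant. *)
Record levy_process (s : R -> {RV P >-> R}) : Prop := LevyProcess {
  levy_start : {ae P, forall w, s 0 w = 0} ;
  levy_indep : forall (n : nat) (t : nat -> R), 0 <= t 0%N ->
    {homo t : i j / (i <= j)%N >-> i <= j} ->
    independent_RVs (fun (i : 'I_n) (w : T) => s (t i.+1) w - s (t i) w) ;
  levy_stationary : forall t h : R, 0 <= t -> 0 <= h ->
    forall B : set R, measurable B ->
      P ((fun w => s (t + h) w - s t w) @^-1` B) =
      P ((fun w => s h w - s 0 w) @^-1` B) }.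

(* In terms of the white noise w = D s: the noise has mean 0 and variance
   sigma0 ^+ 2 times the squared L2 norm of the test function. *)
Definition zero_mean_variance (s : R -> {RV P >-> R}) (sigma0 : R) : Prop :=
  forall t : R, 0 <= t ->
    ('E_P[s t] = 0 /\ 'V_P[s t] = (sigma0 ^+ 2 * t)%R%:E)%E.

(* Joint measurability in (t, w) over [0, 1], off a null event: the regularity
   that makes the integral over [0, 1] of a path, and its expectation,
   meaningful. It holds for every process whose paths are almost surely
   right-continuous with left limits. *)
Definition measurable_paths (s : R -> {RV P >-> R}) : Prop :=
  exists2 A : set T, measurable A /\ P A = 1%E &
    measurable_fun ((`[0, 1] : set R) `*` A) (fun z : R * T => s z.1 z.2).

Definition mse_lin (s : R -> {RV P >-> R}) (M : nat) : \bar R :=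
  (\int[P]_w sq_norm_L2
     (fun t => s t w - haar_lin_approx M (fun u => s u w) t)%R)%E.

End Levy.

(* Main.v *)
(* Let D(I) be the integral over I of the squared deviation of a path from its
   mean on I.  If I is the support of a Haar function of index n >= 1 and I', I''
   are its halves, the squared coefficient of a path f is D(I) - D(I') - D(I''),
   and that of index 0 is ||f||^2 - D([0, 1]).  By orthonormality the squared error
   is therefore D([0, 1]) minus the sum of D(I) - D(I') - D(I'') over the retained
   indices n >= 1.  Since 2 |I| D(I) is the double integral over I x I of
   (f t - f u)^2, and E (s t - s u)^2 = sigma0^2 |t - u| by stationarity, Tonelli
   gives E D(I) = sigma0^2 |I|^2 / 6.  Hence a Haar function of level j >= 0 has mean
   squared coefficient sigma0^2 4^-j / 12. *)
Require Import Defs.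
From HB Require Import structures.
From mathcomp Require Import all_boot all_order all_algebra.
From mathcomp Require Import all_classical all_reals all_analysis.
From mathcomp Require Import measurable_realfun ring lra.

Set Implicit Arguments.
Unset Strict Implicit.
Unset Printing Implicit Defensive.
Import Order.TTheory GRing.Theory Num.Theory.
Import numFieldNormedType.Exports.

Local Open Scope classical_set_scope.
Local Open Scope ring_scope.

(** * Square-integrable functions *)

Section square_integrable.
Context {d} {T : measurableType d} {R : realType}.
Variables (mu : {measure set T -> \bar R}) (D : set T).
Hypothesis mD : measurable D.

(** Measurability of [f] is a separate clause because that of [f ^+ 2] leaves the sign of [f]
    arbitrary. *)
Definition square_integrable (f : T -> R) :=
  measurable_fun D f /\ mu.-integrable D (EFin \o (fun x => f x ^+ 2)).

Lemma square_integrable_mul f g : square_integrable f -> square_integrable g ->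
  mu.-integrable D (EFin \o (fun x => f x * g x)).
Proof.
move=> [mf f2] [mg g2].
apply: (le_integrable mD _ _ (integrableD mD f2 g2)).
  by apply/measurable_EFinP; exact: measurable_funM.
move=> x _ /=; rewrite lee_fin normrM (@ger0_norm _ (_ + _)) ?addr_ge0 ?sqr_ge0//.
(* [|f g| <= f^2 + g^2] follows from the squares of [|f| - |g|] and [|f| + |g|]. *)
rewrite -(real_normK (num_real (f x))) -(real_normK (num_real (g x))).
by have := sqr_ge0 (`|f x| - `|g x|); have := sqr_ge0 (`|f x| + `|g x|); nra.
Qed.

(** The shape [f - c * g] is that of one step of the residual recursion, which subtracts one term of
    the expansion. *)
Lemma square_integrableB f g (c : R) :
  square_integrable f -> square_integrable g ->
  square_integrable (fun x => f x - c * g x).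
Proof.
move=> sf sg; have fg := square_integrable_mul sf sg.
case: sf sg => mf f2 [mg g2]; split.
  by apply: measurable_funB => //; exact: measurable_funM.
apply: (eq_integrable mD (fun x => (f x ^+ 2)%:E +
   ((- (c *+ 2))%:E * (f x * g x)%:E + (c ^+ 2)%:E * (g x ^+ 2)%:E))%E).
  by move=> x _ /=; rewrite -!EFinM -!EFinD; congr EFin; ring.
by apply: integrableD => //; apply: integrableD => //; exact: integrableZl.
Qed.

Lemma Rintegral_Bmul f g h (c : R) : square_integrable f ->
  square_integrable g -> square_integrable h ->
  \int[mu]_(x in D) ((f x - c * g x) * h x) =
  \int[mu]_(x in D) (f x * h x) - c * \int[mu]_(x in D) (g x * h x).
Proof.
move=> sf sg sh.
have fh := square_integrable_mul sf sh; have gh := square_integrable_mul sg sh.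
rewrite -RintegralZl// -RintegralB//.
  by apply: eq_Rintegral => x _; ring.
exact: (integrableZl mD c gh).
Qed.

Lemma Rintegral_sqrB f g (c : R) : square_integrable f -> square_integrable g ->
  \int[mu]_(x in D) (f x - c * g x) ^+ 2 =
  \int[mu]_(x in D) f x ^+ 2 - c *+ 2 * \int[mu]_(x in D) (f x * g x)
  + c ^+ 2 * \int[mu]_(x in D) g x ^+ 2.
Proof.
move=> sf sg; have sfg := square_integrableB c sf sg.
under eq_Rintegral do rewrite expr2.
rewrite Rintegral_Bmul//.
under eq_Rintegral do rewrite mulrC.
rewrite Rintegral_Bmul//.
under [X in _ - c * X = _]eq_Rintegral do rewrite mulrC.
rewrite Rintegral_Bmul//.
under [X in _ - c * (_ - c * X) = _]eq_Rintegral do rewrite -expr2.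
under [X in X - _ - _ = _]eq_Rintegral do rewrite -expr2.
under [X in _ - c * X - _ = _]eq_Rintegral do rewrite mulrC.
by ring.
Qed.

(** * Residuals of orthonormal expansions *)

Section orthonormal.
Variables (h : nat -> T -> R) (f : T -> R).
Hypothesis h_L2 : forall n, square_integrable (h n).
Hypothesis h_orthonormal : forall m n,
  \int[mu]_(x in D) (h m x * h n x) = (m == n)%:R.
Hypothesis f_L2 : square_integrable f.

Let residual M x := f x - \sum_(n < M) (\int[mu]_(x in D) (f x * h n x)) * h n x.

(** Each step removes from the residual its component along [h M], which lowers the squared norm by
    exactly [c M ^+ 2]. *)
Let residual_induction (c : nat -> R) (e : nat -> T -> R) :
  (forall n, c n = \int[mu]_(x in D) (f x * h n x)) ->
  e 0%N = f -> (forall M, e M.+1 = fun x => e M x - c M * h M x) ->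
  forall M, square_integrable (e M) /\
    \int[mu]_(x in D) e M x ^+ 2 =
    \int[mu]_(x in D) f x ^+ 2 - \sum_(n < M) c n ^+ 2.
Proof.
move=> cE e0 eS.
have sq M : square_integrable (e M).
  by elim: M => [|M IH]; rewrite ?e0// eS; exact: square_integrableB.
(* By orthogonality the terms already subtracted do not affect the coefficient along a later
   [h k]. *)
have ec N k : (N <= k)%N -> \int[mu]_(x in D) (e N x * h k x) = c k.
  elim: N => [_|N IH Nk]; first by rewrite e0 cE.
  rewrite eS Rintegral_Bmul// (h_orthonormal N k) (ltn_eqF Nk) mulr0 subr0.
  exact: IH (ltnW Nk).
elim=> [|M [_ IH]]; first by split; rewrite ?big_ord0 ?subr0 e0.
split=> //; rewrite eS Rintegral_sqrB// ec// IH big_ord_recr/=.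
under [X in _ + _ * X]eq_Rintegral do rewrite expr2.
by rewrite (h_orthonormal M M) eqxx mulr1; ring.
Qed.

Let residualP M : square_integrable (residual M) /\
  \int[mu]_(x in D) residual M x ^+ 2 = \int[mu]_(x in D) f x ^+ 2 -
    \sum_(n < M) (\int[mu]_(x in D) (f x * h n x)) ^+ 2.
Proof.
apply: (residual_induction (c := fun n => \int[mu]_(x in D) (f x * h n x))) => //.
  by apply/funext => x; rewrite /residual big_ord0 subr0.
by move=> N; apply/funext => x; rewrite /residual big_ord_recr/= opprD addrA.
Qed.

Lemma square_integrable_residual M : square_integrable
  (fun x => f x - \sum_(n < M) (\int[mu]_(x in D) (f x * h n x)) * h n x).
Proof. exact: (residualP M).1. Qed.

Lemma Rintegral_residual_sqr M :
  \int[mu]_(x in D)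
    (f x - \sum_(n < M) (\int[mu]_(x in D) (f x * h n x)) * h n x) ^+ 2 =
  \int[mu]_(x in D) f x ^+ 2 -
    \sum_(n < M) (\int[mu]_(x in D) (f x * h n x)) ^+ 2.
Proof. exact: (residualP M).2. Qed.

End orthonormal.
End square_integrable.

(** * Integrals of [|t - u|] *)

Section integral_polynomials.
Context {R : realType}.
Notation mu := (@lebesgue_measure R).

Lemma integral_deriv_poly (p : {poly R}) (a b : R) : a <= b ->
  (\int[mu]_(x in `[a, b]) (p^`().[x])%:E = (p.[b] - p.[a])%:E)%E.
Proof.
rewrite le_eqVlt => /predU1P[<-|ab].
  by rewrite set_itv1 integral_set1 subrr.
rewrite (continuous_FTC2 (F := horner p)) ?EFinB//.
- by apply: continuous_subspaceT => x; exact: continuous_horner.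
- split.
  + by move=> x _; exact: derivable_horner.
  + by apply: cvg_at_right_filter; exact: continuous_horner.
  + by apply: cvg_at_left_filter; exact: continuous_horner.
- by move=> x _; rewrite derivE.
Qed.

Lemma integral_abs_sub (a b u : R) : a <= u -> u <= b ->
  (\int[mu]_(t in `[a, b]) `|t - u|%:E =
   (((u - a) ^+ 2 + (b - u) ^+ 2) / 2)%:E)%E.
Proof.
move=> au ub.
have mabs D : measurable_fun D (fun t : R => `|t - u|%:E).
  apply: measurable_funTS; apply/measurable_EFinP.
  by apply: measurableT_comp => //; exact: measurable_funB.
(* [p] is the antiderivative of [t - u] that vanishes at [u]; the sign of [t - u] splits the
   interval at [u]. *)
pose p : {poly R} := (2^-1)%:P * ('X - u%:P) ^+ 2.
have dp x : p^`().[x] = x - u.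
  rewrite /p derivM derivC mul0r add0r !deriv_exp !derivXsubC.
  rewrite !(hornerM, hornerC, hornerX, hornerN, hornerD, horner_exp, hornerMn)/=.
  by field.
have pE x : p.[x] = (x - u) ^+ 2 / 2.
  by rewrite /p hornerM hornerC horner_exp hornerXsubC; field.
have left : (\int[mu]_(t in `[a, u]) `|t - u|%:E = ((a - u) ^+ 2 / 2)%:E)%E.
  rewrite (@eq_integral _ _ _ mu _ (fun t => ((- p)^`().[t])%:E)); last first.
    move=> x; rewrite inE/= in_itv/= => /andP[_ xu].
    by rewrite derivN hornerN dp ler0_norm// subr_le0.
  by rewrite integral_deriv_poly// !hornerN !pE; congr EFin; field.
have right : (\int[mu]_(t in `]u, b]) `|t - u|%:E = ((b - u) ^+ 2 / 2)%:E)%E.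
  rewrite integral_itv_obnd_cbnd//.
  rewrite (@eq_integral _ _ _ mu _ (fun t => (p^`().[t])%:E)); last first.
    move=> x; rewrite inE/= in_itv/= => /andP[ux _].
    by rewrite dp ger0_norm// subr_ge0.
  by rewrite integral_deriv_poly// !pE; congr EFin; field.
rewrite (@itv_bndbnd_setU _ _ _ (BRight u)) ?bnd_simp// ge0_integral_setU//=.
- by rewrite left right -EFinD; congr EFin; field.
- exact: mabs.
- rewrite disj_set2E; apply/eqP; rewrite -subset0 => x [] /=.
  by rewrite !in_itv/= => /andP[_ +] /andP[+ _]; rewrite leNgt => /negP.
Qed.

Lemma integral_integral_abs_sub (a b : R) : a <= b ->
  (\int[mu]_(u in `[a, b]) \int[mu]_(t in `[a, b]) `|t - u|%:E =
   ((b - a) ^+ 3 / 3)%:E)%E.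
Proof.
move=> ab.
(* An antiderivative of the inner integral, taken as a function of its parameter. *)
pose p : {poly R} := (6^-1)%:P * (('X - a%:P) ^+ 3 + ('X - b%:P) ^+ 3).
have pE x : p^`().[x] = ((x - a) ^+ 2 + (b - x) ^+ 2) / 2.
  rewrite /p derivM derivC mul0r add0r derivD !deriv_exp !derivXsubC.
  rewrite !(hornerM, hornerC, hornerX, hornerN, hornerD, horner_exp, hornerMn)/=.
  by field.
rewrite (@eq_integral _ _ _ mu _ (fun t => (p^`().[t])%:E)); last first.
  by move=> x; rewrite inE/= in_itv/= => /andP[ax xb]; rewrite integral_abs_sub// pE.
rewrite integral_deriv_poly//; congr EFin.
rewrite /p !(hornerM, hornerC, hornerX, hornerN, hornerD, horner_exp)/=.
by field.
Qed.

End integral_polynomials.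

(** * The Haar basis *)

Section haar_basis.
Context {R : realType}.
Notation mu := (@lebesgue_measure R).
Local Notation L2 := (square_integrable mu `[0, 1]).

Definition haar_level (n : nat) : nat := trunc_log 2 n.
Definition haar_shift (n : nat) : nat := (n - 2 ^ haar_level n)%N.
Definition haar_scale (n : nat) : R := 2 `^ ((haar_level n)%:R / 2).
(** For [n >= 1] the support of [haar n] runs from [haar_lo n] to [haar_hi n], with the sign change
    at [haar_mid n]. *)
Definition haar_lo (n : nat) : R := (haar_shift n)%:R / 2 ^+ haar_level n.
Definition haar_mid (n : nat) : R :=
  ((haar_shift n)%:R + 1 / 2) / 2 ^+ haar_level n.
Definition haar_hi (n : nat) : R := (haar_shift n).+1%:R / 2 ^+ haar_level n.

Let pow_gt0 j : 0 < 2 ^+ j :> R. Proof. by rewrite exprn_gt0. Qed.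

Lemma haar_indexE n : (0 < n)%N -> n = (2 ^ haar_level n + haar_shift n)%N.
Proof. by move=> n0; rewrite subnKC// trunc_logP. Qed.

Lemma haar_shift_lt n : (0 < n)%N -> (haar_shift n < 2 ^ haar_level n)%N.
Proof.
move=> n0; rewrite ltn_subLR ?trunc_logP// addnn -mul2n -expnS.
exact: trunc_log_ltn.
Qed.

Lemma haar_scale_sqr n : haar_scale n ^+ 2 = 2 ^+ haar_level n.
Proof.
by rewrite /haar_scale -powR_mulrn ?powR_ge0// -powRrM divfK ?pnatr_eq0// powR_mulrn.
Qed.

Lemma haar_lo_ge0 n : 0 <= haar_lo n.
Proof. by rewrite divr_ge0// ltW. Qed.

Lemma haar_hi_le1 n : (0 < n)%N -> haar_hi n <= 1.
Proof.
by move=> n0; rewrite ler_pdivrMr// mul1r -natrX ler_nat haar_shift_lt.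
Qed.

Lemma haar_mid_sub_lo n : haar_mid n - haar_lo n = (2 ^+ haar_level n)^-1 / 2.
Proof. by rewrite /haar_mid /haar_lo; field; exact: lt0r_neq0. Qed.

Lemma haar_hi_sub_mid n : haar_hi n - haar_mid n = (2 ^+ haar_level n)^-1 / 2.
Proof.
by rewrite /haar_mid /haar_hi -[(haar_shift n).+1%:R]natr1; field; exact: lt0r_neq0.
Qed.

Lemma haar_hi_sub_lo n : haar_hi n - haar_lo n = (2 ^+ haar_level n)^-1.
Proof.
rewrite -(subrK (haar_mid n) (haar_hi n)) -addrA haar_mid_sub_lo haar_hi_sub_mid.
by rewrite -splitr.
Qed.

Lemma haar_lo_lt_mid n : haar_lo n < haar_mid n.
Proof. by rewrite -subr_gt0 haar_mid_sub_lo divr_gt0// invr_gt0. Qed.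

Lemma haar_mid_lt_hi n : haar_mid n < haar_hi n.
Proof. by rewrite -subr_gt0 haar_hi_sub_mid divr_gt0// invr_gt0. Qed.

Lemma haarE n : (0 < n)%N -> haar n = fun t : R =>
  haar_scale n * (\1_`[haar_lo n, haar_mid n] t - \1_`[haar_mid n, haar_hi n] t).
Proof.
move=> n0; apply/funext => t.
rewrite /haar gtn_eqF//= /haar_psi /haar_mother -/(haar_level n) -/(haar_shift n).
rewrite !indicE !mem_setE !in_itv/= /haar_lo /haar_mid /haar_hi.
rewrite -[(haar_shift n).+1%:R]natr1.
move: (haar_shift n)%:R (2 ^+ _) (pow_gt0 (haar_level n)) => k q q0.
rewrite !(ler_pdivlMr _ _ q0) !(ler_pdivrMr _ _ q0) (mulrC t q).
by congr (_ * ((_ && _)%:R - (_ && _)%:R)); apply/idP/idP; lra.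
Qed.

Lemma square_integrable_indic (a b : R) : L2 \1_`[a, b].
Proof.
split; first exact: measurable_indic.
rewrite [X in integrable _ _ X](_ : _ = EFin \o \1_`[a, b]); last first.
  by apply/funext => x /=; rewrite indicE; case: (_ \in _); rewrite ?expr1n ?expr0n.
by apply: integrableS (integrable_indic_itv a b true false).
Qed.

Lemma square_integrable_haar n : L2 (haar n : R -> R).
Proof.
have [->|n0] := posnP n; first exact: square_integrable_indic.
have z : L2 (cst 0).
  split => //; rewrite [X in integrable _ _ X](_ : _ = cst 0%E).
    exact: integrable0.
  by apply/funext => x /=; rewrite expr0n.
have i a b := square_integrable_indic a b.
rewrite haarE// (_ : (fun _ => _) = fun x => 0 - (- haar_scale n) *
  (\1_`[haar_lo n, haar_mid n] x - 1 * \1_`[haar_mid n, haar_hi n] x)).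
  by apply: square_integrableB => //; exact: square_integrableB.
by apply/funext => x; ring.
Qed.

(** On a set of finite measure square integrability implies integrability: the indicator of [0, 1]
    serves as the second factor. *)
Lemma square_integrable_integrable f : L2 f -> mu.-integrable `[0, 1] (EFin \o f).
Proof.
move=> sf; have := square_integrable_mul _ sf (square_integrable_indic 0 1).
move=> /(_ (measurable_itv _)); apply: eq_integrable => // x.
by rewrite inE/= indicE => x01; rewrite mem_set ?mulr1.
Qed.

Lemma Rintegral_mul_indic (D E : set R) (f : R -> R) :
  \int[mu]_(t in D) (f t * \1_E t) = \int[mu]_(t in D `&` E) f t.
Proof.
rewrite Rintegral_mkcondr; apply: eq_Rintegral => t _.
by rewrite patchE indicE; case: (_ \in _); rewrite ?mulr1 ?mulr0.
Qed.

Lemma setI_itvcc (x y a b : R) :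
  `[x, y] `&` `[a, b] = `[Num.max x a, Num.min y b]%classic.
Proof.
apply/seteqP; split=> t; rewrite /= !in_itv/= ge_max le_min.
  by move=> [/andP[-> ->] /andP[-> ->]].
by move=> /andP[/andP[-> ->] /andP[-> ->]].
Qed.

Lemma Rintegral_1_setI_itv (x y a b : R) :
  \int[mu]_(t in `[x, y] `&` `[a, b]) 1 =
  Num.max 0 (Num.min y b - Num.max x a).
Proof.
rewrite setI_itvcc Rintegral_cst// mul1r /= lebesgue_measure_itv/= lte_fin.
by case: ltP; [rewrite -subr_gt0 -EFinB/= => /ltW/max_r| rewrite -subr_le0 => /max_l].
Qed.

Lemma Rintegral_mul_haar n (f : R -> R) (D : set R) : (0 < n)%N ->
  measurable D -> mu.-integrable D (EFin \o f) ->
  \int[mu]_(t in D) (f t * haar n t) = haar_scale n *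
    (\int[mu]_(t in D `&` `[haar_lo n, haar_mid n]) f t -
     \int[mu]_(t in D `&` `[haar_mid n, haar_hi n]) f t).
Proof.
move=> n0 mD fi.
have fI a b : mu.-integrable D (EFin \o (fun t => f t * \1_`[a, b] t)).
  apply: (@le_integrable _ _ _ mu D mD _ _ _ _ fi).
    apply/measurable_EFinP; apply: measurable_funM => //.
    by have := measurable_int mu fi; move/measurable_EFinP.
  move=> t _ /=; rewrite lee_fin normrM indicE.
  by case: (_ \in _); rewrite ?normr1 ?mulr1 ?normr0 ?mulr0.
rewrite -!Rintegral_mul_indic -RintegralB// -RintegralZl//.
  by apply: eq_Rintegral => t _; rewrite haarE//; ring.
exact: (@integrableB _ _ _ mu D mD _ _ (fI _ _) (fI _ _)).
Qed.

(** Each [Num.max 0 _] is the length of the overlap of [[x, y]] with one half of the support. *)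
Lemma Rintegral_haar n (x y : R) : (0 < n)%N ->
  \int[mu]_(t in `[x, y]) haar n t = haar_scale n *
    (Num.max 0 (Num.min y (haar_mid n) - Num.max x (haar_lo n)) -
     Num.max 0 (Num.min y (haar_hi n) - Num.max x (haar_mid n))).
Proof.
move=> n0; under eq_Rintegral do rewrite -[haar n _]mul1r.
rewrite Rintegral_mul_haar ?Rintegral_1_setI_itv//.
apply: measurable_bounded_integrable => //; last exact: bounded_cst.
by rewrite /= lebesgue_measure_itv/=; case: ifP => // _; rewrite -EFinB ltry.
Qed.

(** Either [[x, y]] meets the support in at most a point, or it contains the support and the two
    halves, of equal length and opposite sign, cancel. *)
Lemma Rintegral_haar_outside n (x y : R) : (0 < n)%N ->
  x <= y -> ~~ (haar_lo n < x < haar_hi n) -> ~~ (haar_lo n < y < haar_hi n) ->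
  \int[mu]_(t in `[x, y]) haar n t = 0.
Proof.
move=> n0 xy; rewrite Rintegral_haar//.
have := haar_mid_sub_lo n; rewrite -(haar_hi_sub_mid n).
have := haar_lo_lt_mid n; have := haar_mid_lt_hi n.
move: (haar_lo n) (haar_mid n) (haar_hi n) => a b c bc ab acb xP yP.
apply/eqP; rewrite mulf_eq0 subr_eq0; apply/orP; right; apply/eqP.
rewrite /Num.max /Num.min.
move: xP yP; rewrite !negb_and -!leNgt => /orP xP /orP yP.
by case: (ltP y b) => ?; case: (ltP y c) => ?; case: (ltP x a) => ?;
  case: (ltP x b) => ?; do ! case: ltP => ?; case: xP => ?; case: yP => ?; lra.
Qed.

(** No integer lies strictly between the shift and its successor. *)
Lemma dyadic_outside n p : (0 < n)%N ->
  ~~ (haar_lo n < p%:R / 2 ^+ haar_level n < haar_hi n).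
Proof.
move=> n0; rewrite /haar_lo /haar_hi !ltr_pM2r ?invr_gt0// !ltr_nat.
by rewrite ltnS ltnNge andNb.
Qed.

Lemma dyadic_refine p i j : (i <= j)%N ->
  exists q, p%:R / 2 ^+ i = q%:R / 2 ^+ j :> R.
Proof.
move=> ij; exists (p * 2 ^ (j - i))%N.
have nz k : 2 ^+ k != 0 :> R by exact: lt0r_neq0.
apply/eqP; rewrite eqr_div// natrM natrX -mulrA -exprD subnK//.
Qed.

(* This is what makes the system orthogonal: the breakpoints of [haar m] are
   dyadic of level at most that of the support of any later [haar n], unless both
   have the same level, where the supports do not overlap. *)
Lemma haar_endpoints_outside m n : (0 < m)%N -> (m < n)%N ->
  [/\ ~~ (haar_lo n < haar_lo m < haar_hi n),
      ~~ (haar_lo n < haar_mid m < haar_hi n) &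
      ~~ (haar_lo n < haar_hi m < haar_hi n)].
Proof.
move=> m0 mn; have n0 := ltn_trans m0 mn.
have le : (haar_level m <= haar_level n)%N := leq_trunc_log 2 (ltnW mn).
have out p i : (i <= haar_level n)%N -> ~~ (haar_lo n < p%:R / 2 ^+ i < haar_hi n).
  by move=> /(dyadic_refine p)[q ->]; exact: dyadic_outside.
split; [exact: out| |exact: out].
move: le; rewrite leq_eqVlt => /predU1P[eqmn|lt].
  have mid_hi := haar_mid_lt_hi m.
  suff : haar_hi m <= haar_lo n.
    by move=> h; rewrite negb_and -!leNgt; apply/orP; left; lra.
  rewrite /haar_hi /haar_lo eqmn ler_pM2r ?invr_gt0// ler_nat.
  by move: mn; rewrite {1}(haar_indexE m0) {1}(haar_indexE n0) eqmn ltn_add2l.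
rewrite (_ : haar_mid m = (haar_shift m).*2.+1%:R / 2 ^+ (haar_level m).+1).
  exact: out.
by rewrite /haar_mid -[_.*2.+1%:R]natr1 -muln2 natrM exprS; field; exact: lt0r_neq0.
Qed.

(** [haar m] is constant on each half of its support, so for [m > 0] the integral is a multiple of a
    difference of two integrals of [haar n]. Both run over intervals with no endpoint inside the
    support of [haar n], hence vanish. *)
Lemma haar_orthogonal m n : (m < n)%N ->
  \int[mu]_(t in `[0, 1]) (haar m t * haar n t) = 0.
Proof.
move=> mn; have n0 := leq_ltn_trans (leq0n m) mn.
under eq_Rintegral do rewrite mulrC.
have [->|m0] := posnP m.
  rewrite Rintegral_mul_indic setIid; apply: Rintegral_haar_outside => //.
    by rewrite (le_gtF (haar_lo_ge0 _)).
  by rewrite (le_gtF (haar_hi_le1 n0)) andbF.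
have hi := square_integrable_integrable (square_integrable_haar n).
rewrite Rintegral_mul_haar// !setI_itvcc.
have [lo mid hi'] := haar_endpoints_outside m0 mn.
have l0 := haar_lo_ge0 m; have h1 := haar_hi_le1 m0.
have lm := haar_lo_lt_mid m; have mh := haar_mid_lt_hi m.
rewrite !max_r ?min_r; try lra.
by rewrite !Rintegral_haar_outside ?subrr ?mulr0// ltW.
Qed.

Lemma haar_normalized n : \int[mu]_(t in `[0, 1]) (haar n t * haar n t) = 1 :> R.
Proof.
have [->|n0] := posnP n.
  rewrite Rintegral_mul_indic setIid.
  under eq_Rintegral do rewrite -[haar 0 _]mul1r.
  rewrite Rintegral_mul_indic Rintegral_1_setI_itv minxx maxxx subr0.
  by rewrite max_r.
have hi := square_integrable_integrable (square_integrable_haar n).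
(* One factor is kept as integrand; over the halves it integrates to plus and minus [q] times the
   half-length. The total is [q^2 / Q] with [q^2 = Q = 2^j]. *)
rewrite Rintegral_mul_haar// !setI_itvcc !Rintegral_haar//.
have l0 := haar_lo_ge0 n; have h1 := haar_hi_le1 n0.
have lm := haar_lo_lt_mid n; have mh := haar_mid_lt_hi n.
have lmE := (max_r (ltW lm), max_l (ltW lm)).
have mhE := (min_l (ltW mh), min_r (ltW mh)).
rewrite (max_r l0) (min_r h1) (@max_r _ _ 0 (haar_mid n)); last lra.
rewrite (@min_r _ _ 1 (haar_mid n)); last lra.
rewrite !minxx !maxxx !lmE !mhE !subrr !maxxx.
rewrite !max_r ?subr_ge0 ?(ltW lm) ?(ltW mh)//.
rewrite haar_mid_sub_lo haar_hi_sub_mid.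
have := haar_scale_sqr n; have := lt0r_neq0 (pow_gt0 (haar_level n)).
move: (haar_scale n) (2 ^+ haar_level n) => q Q Q0 qQ.
transitivity (q ^+ 2 / Q); last by rewrite qQ divff.
by field.
Qed.

Lemma haar_orthonormal m n :
  \int[mu]_(t in `[0, 1]) (haar m t * haar n t) = (m == n)%:R :> R.
Proof.
case: (ltngtP m n) => [|nm|->]; [exact: haar_orthogonal| |exact: haar_normalized].
by under eq_Rintegral do rewrite mulrC; exact: haar_orthogonal.
Qed.

End haar_basis.

(** * Squared Haar coefficients *)

Section dispersion.
Context {R : realType}.
Notation mu := (@lebesgue_measure R).
Local Notation L2 := (square_integrable mu `[0, 1]).

Lemma EFin_Rintegral d (T : measurableType d) (m : {measure set T -> \bar R})
    (D : set T) (f : T -> R) : measurable D -> m.-integrable D (EFin \o f) ->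
  (\int[m]_(x in D) (f x)%:E)%E = (\int[m]_(x in D) f x)%:E.
Proof. by move=> mD fi; rewrite /Rintegral fineK//; exact: integrable_fin_num. Qed.

(** Square integrability of the constant 1 says that [D] has finite measure. Expanding the square
    for fixed [u] leaves a quadratic polynomial in [f u], which is then integrated in [u]. *)
Lemma double_integral_sqr_sub d (T : measurableType d)
    (m : {measure set T -> \bar R}) (D : set T) (f : T -> R) :
  measurable D -> square_integrable m D (cst 1) -> square_integrable m D f ->
  (\int[m]_(u in D) \int[m]_(t in D) ((f t - f u) ^+ 2)%:E)%E =
  (2 * (\int[m]_(x in D) f x ^+ 2 * \int[m]_(x in D) 1 -
        (\int[m]_(x in D) f x) ^+ 2))%:E.
Proof.
move=> mD s1 sf.
have i1 : m.-integrable D (EFin \o (fun=> 1)).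
  case: s1 => _; apply: eq_integrable => // x _ /=; by rewrite expr1n.
have i2 := sf.2.
have if_ : m.-integrable D (EFin \o f).
  apply: eq_integrable (square_integrable_mul mD sf s1) => // x _ /=.
  by rewrite mulr1.
set A := \int[m]_(x in D) f x ^+ 2.
set S := \int[m]_(x in D) f x.
set L := \int[m]_(x in D) 1.
have inner u : (\int[m]_(t in D) ((f t - f u) ^+ 2)%:E)%E =
    (A * 1 + (- (S *+ 2) * f u + L * f u ^+ 2))%:E.
  have su := square_integrableB mD (f u) sf s1.
  transitivity (\int[m]_(t in D) ((f t - f u * cst 1 t) ^+ 2)%:E)%E.
    by apply: eq_integral => t _; rewrite /= mulr1.
  rewrite EFin_Rintegral//; last exact: su.2.
  rewrite Rintegral_sqrB//; congr EFin.
  under [X in _ - _ * X + _]eq_Rintegral do rewrite /= mulr1.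
  under [X in _ - _ + _ * X]eq_Rintegral do rewrite /= expr1n.
  by rewrite -/A -/S -/L; ring.
under eq_integral do rewrite inner.
have iS : m.-integrable D (EFin \o (fun u => - (S *+ 2) * f u)).
  exact: (@integrableZl _ _ _ m D mD _ _ if_).
have iL : m.-integrable D (EFin \o (fun u => L * f u ^+ 2)).
  exact: (@integrableZl _ _ _ m D mD _ _ i2).
have iA : m.-integrable D (EFin \o (fun u => A * 1)).
  exact: (@integrableZl _ _ _ m D mD _ _ i1).
have iSL : m.-integrable D (EFin \o (fun u => - (S *+ 2) * f u + L * f u ^+ 2)).
  exact: (@integrableD _ _ _ m D mD _ _ iS iL).
rewrite EFin_Rintegral//; last exact: (@integrableD _ _ _ m D mD _ _ iA iSL).
rewrite RintegralD// RintegralD// !RintegralZl// -/A -/S -/L.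
by congr EFin; ring.
Qed.

(* This is the squared L2 distance from [f] to the constants on [a, b]. *)
Definition dispersion (a b : R) (f : R -> R) : R :=
  \int[mu]_(t in `[a, b]) f t ^+ 2 - (\int[mu]_(t in `[a, b]) f t) ^+ 2 / (b - a).

Lemma square_integrableS d (T : measurableType d) (m : {measure set T -> \bar R})
    (D E : set T) (f : T -> R) : measurable D -> measurable E -> E `<=` D ->
  square_integrable m D f -> square_integrable m E f.
Proof.
move=> mD mE ED [mf f2]; split; first exact: measurable_funS mf.
exact: integrableS f2.
Qed.

Lemma subset_unit (a b : R) : 0 <= a -> b <= 1 -> `[a, b] `<=` `[0, 1].
Proof. by move=> a0 b1; apply: subset_itv; rewrite bnd_simp. Qed.

Lemma square_integrable_cst (a b c : R) : square_integrable mu `[a, b] (cst c).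
Proof.
split=> //.
apply: (@measurable_bounded_integrable _ _ _ mu (cst (c ^+ 2))) => //.
- by rewrite /= lebesgue_measure_itv/=; case: ifP => // _; rewrite -EFinB ltry.
- exact: bounded_cst.
Qed.

(** This form of the dispersion involves only increments of [f], whose second moments are known for
    a Lévy path. It also makes sign and measurability evident. *)
Lemma integral_sqr_sub_dispersion (a b : R) (f : R -> R) :
  0 <= a -> a < b -> b <= 1 -> L2 f ->
  (\int[mu]_(u in `[a, b]) \int[mu]_(t in `[a, b]) ((f t - f u) ^+ 2)%:E)%E =
  (2 * (b - a) * dispersion a b f)%:E.
Proof.
move=> a0 ab b1 sf; rewrite double_integral_sqr_sub//.
- rewrite /dispersion Rintegral_cst//= lebesgue_measure_itv/= lte_fin ab -EFinB/=.
  by congr EFin; field; rewrite subr_eq0 gt_eqF.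
- exact: square_integrable_cst.
- by apply: square_integrableS sf => //; exact: subset_unit.
Qed.

Lemma Rintegral_itv_split (f : R -> R) (a b c : R) : a <= b -> b <= c ->
  mu.-integrable `[a, c] (EFin \o f) ->
  \int[mu]_(t in `[a, c]) f t =
  \int[mu]_(t in `[a, b]) f t + \int[mu]_(t in `[b, c]) f t.
Proof.
move=> ab bc fi.
rewrite -(Rintegral_itv_obnd_cbnd (r := b)); last first.
  by apply: integrableS fi => //; apply: subset_itv; rewrite bnd_simp.
by rewrite -(Rintegral_itvB fi (x := b)) ?bnd_simp// addrC subrK.
Qed.

(* Refining the approximation on the support of [haar n] from one constant to two
   lowers the squared error by the squared coefficient. *)
Lemma haar_coef_sqr n (f : R -> R) : (0 < n)%N -> L2 f ->
  haar_coef f n ^+ 2 = dispersion (haar_lo n) (haar_hi n) f -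
    (dispersion (haar_lo n) (haar_mid n) f + dispersion (haar_mid n) (haar_hi n) f).
Proof.
move=> n0 sf; have fi := square_integrable_integrable sf.
have l0 := @haar_lo_ge0 R n; have h1 := @haar_hi_le1 R _ n0.
have lm := @haar_lo_lt_mid R n; have mh := @haar_mid_lt_hi R n.
have sub : `[haar_lo n, haar_hi n] `<=` `[(0 : R), 1] by exact: subset_unit.
rewrite /dispersion (@Rintegral_itv_split _ _ (haar_mid n))// ?ltW//; last first.
  exact: integrableS sf.2.
rewrite (@Rintegral_itv_split f _ (haar_mid n))// ?ltW//; last first.
  exact: integrableS fi.
rewrite /haar_coef Rintegral_mul_haar// !setI_itvcc.
rewrite !max_r ?(le_trans l0 (ltW lm))// !min_r//; last exact: le_trans (ltW mh) h1.
rewrite haar_hi_sub_lo haar_mid_sub_lo haar_hi_sub_mid exprMn haar_scale_sqr.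
have : 2 ^+ haar_level n != 0 :> R by rewrite expf_eq0 pnatr_eq0 andbF.
(* With [S'] and [S''] the integrals of [f] over the halves, those of [f^2] cancel and what remains
   is [q (S' - S'')^2 = 2q S'^2 + 2q S''^2 - q (S' + S'')^2]. *)
move: (2 ^+ _) => q q0; field.
by rewrite q0.
Qed.

Lemma haar_coef0 (f : R -> R) : haar_coef f 0 = \int[mu]_(t in `[0, 1]) f t.
Proof. by rewrite /haar_coef Rintegral_mul_indic setIid. Qed.

Lemma sq_norm_haar_residual (f : R -> R) (M : nat) : (0 < M)%N -> L2 f ->
  sq_norm_L2 (fun t => f t - haar_lin_approx M f t) =
  (dispersion 0 1 f - \sum_(1 <= n < M) (dispersion (haar_lo n) (haar_hi n) f -
    (dispersion (haar_lo n) (haar_mid n) f +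
     dispersion (haar_mid n) (haar_hi n) f)))%:E.
Proof.
move=> M0 sf.
have hL2 := @square_integrable_haar R; have ho := @haar_orthonormal R.
rewrite /sq_norm_L2 EFin_Rintegral//; last first.
  exact: (@square_integrable_residual _ _ _ mu _ (measurable_itv _) _ _ hL2 ho sf M).2.
rewrite (@Rintegral_residual_sqr _ _ _ mu _ (measurable_itv _) _ _ hL2 ho sf M).
congr EFin.
(* The coefficient of index 0 is the mean over [0, 1]; its square turns the squared norm into
   [dispersion 0 1 f]. *)
rewrite -(big_mkord xpredT (fun n => haar_coef f n ^+ 2)) big_ltn//.
rewrite haar_coef0 opprD addrA; congr (_ - _).
  by rewrite /dispersion subr0 divr1.
by apply: eq_big_nat => n /andP[n0 _]; exact: haar_coef_sqr.
Qed.

End dispersion.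

(** * Mean squares *)

Section tonelli_restricted.
Context {d1 d2} {T1 : measurableType d1} {T2 : measurableType d2} {R : realType}.
Variables (D : set T1) (f : T1 * T2 -> \bar R).
Hypotheses (mD : measurable D) (mf : measurable_fun [set: T1 * T2] f).
Hypothesis f0 : forall z, (0 <= f z)%E.

(** Extension by zero off [D] turns the integral over [D] into one over the whole space, where
    Tonelli's theorem applies. *)
Let g := f \_ (fst @^-1` D).

Let gE x y : g (x, y) = ((fun x => f (x, y)) \_ D) x.
Proof. by rewrite /g !patchE. Qed.

Let mg : measurable_fun [set: T1 * T2] g.
Proof.
have mfD : measurable (fst @^-1` D : set (T1 * T2)).
  by rewrite -[X in measurable X]setTI; exact: measurable_fst.
have mfS : measurable_fun (fst @^-1` D) f by apply: measurable_funS mf.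
exact: (measurable_restrictT f mfD).1 mfS.
Qed.

Let g0 z : (0 <= g z)%E.
Proof. by rewrite /g patchE; case: ifP. Qed.

Lemma measurable_integral_restricted (m1 : {sigma_finite_measure set T1 -> \bar R}) :
  measurable_fun [set: T2] (fun y => \int[m1]_(x in D) f (x, y))%E.
Proof.
have := measurable_fun_fubini_tonelli_G (m1 := m1) g mg g0.
rewrite (_ : fubini_G _ _ = fun y => \int[m1]_(x in D) f (x, y))%E//.
apply/funext => y; rewrite /fubini_G [RHS]integral_mkcond.
by apply: eq_integral => x _; rewrite gE.
Qed.

Lemma tonelli_restricted (m1 : {sigma_finite_measure set T1 -> \bar R})
    (m2 : {sigma_finite_measure set T2 -> \bar R}) :
  (\int[m2]_y \int[m1]_(x in D) f (x, y) =
   \int[m1]_(x in D) \int[m2]_y f (x, y))%E.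
Proof.
transitivity (\int[m2]_y \int[m1]_x g (x, y))%E.
  apply: eq_integral => y _; rewrite integral_mkcond.
  by apply: eq_integral => x _; rewrite gE.
rewrite -fubini_tonelli// [RHS]integral_mkcond; apply: eq_integral => x _.
rewrite patchE; case: ifPn => xD; last first.
  by apply: integral0_eq => y _; rewrite gE patchE (negbTE xD).
by apply: eq_integral => y _; rewrite gE patchE xD.
Qed.

End tonelli_restricted.

Section tonelli_itv.
Context {d} {T : measurableType d} {R : realType}.
Variables (f : R * T -> \bar R) (a b : R).
Hypothesis mf : measurable_fun [set: R * T] f.
Hypothesis f0 : forall z, (0 <= f z)%E.
Notation mu := (@lebesgue_measure R).

Lemma measurable_integral_itv :
  measurable_fun [set: T] (fun y => \int[mu]_(x in `[a, b]) f (x, y))%E.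
Proof.
exact: (@measurable_integral_restricted _ _ (measurableTypeR R) T R `[a, b]%classic
  f (measurable_itv _) mf f0 mu).
Qed.

Lemma tonelli_itv (P : {sigma_finite_measure set T -> \bar R}) :
  (\int[P]_y \int[mu]_(x in `[a, b]) f (x, y) =
   \int[mu]_(x in `[a, b]) \int[P]_y f (x, y))%E.
Proof.
exact: (@tonelli_restricted _ _ (measurableTypeR R) T R `[a, b]%classic
  f (measurable_itv _) mf f0 mu P).
Qed.

End tonelli_itv.

(** * Expected dispersions and expected squared error *)

Section mean_square_increments.
Context {d} {T : measurableType d} {R : realType}.
Variables (P : probability T R) (X : R -> T -> R) (sigma0 : R).
Notation mu := (@lebesgue_measure R).
Hypothesis mX : measurable_fun [set: R * T] (fun z : R * T => X z.1 z.2).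
Hypothesis X_L2 : forall w, square_integrable mu `[0, 1] (X^~ w).
Hypothesis X_increment : forall t u, 0 <= t <= 1 -> 0 <= u <= 1 ->
  (\int[P]_w ((X t w - X u w) ^+ 2)%:E = (sigma0 ^+ 2 * `|t - u|)%:E)%E.

(** The argument is [(t, (u, w))]: integrating out [t] leaves a function of [(u, w)], ready for a
    second use of Tonelli's theorem. *)
Let sqr_increment : R * (R * T) -> \bar R :=
  fun z => ((X z.1 z.2.2 - X z.2.1 z.2.2) ^+ 2)%:E.

Let measurable_sqr_increment : measurable_fun [set: R * (R * T)] sqr_increment.
Proof.
apply/measurable_EFinP; apply: measurable_funX; apply: measurable_funB.
  apply: (measurableT_comp mX (g := fun z : R * (R * T) => (z.1, z.2.2))).
  apply: measurable_fun_pair; first exact: measurable_fst.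
  exact: (measurableT_comp measurable_snd measurable_snd).
apply: (measurableT_comp mX (g := fun z : R * (R * T) => (z.2.1, z.2.2))).
apply: measurable_fun_pair.
  exact: (measurableT_comp measurable_fst measurable_snd).
exact: (measurableT_comp measurable_snd measurable_snd).
Qed.

Let measurable_inner (a b : R) : measurable_fun [set: R * T]
  (fun y => \int[mu]_(t in `[a, b]) sqr_increment (t, y))%E.
Proof.
apply: (measurable_integral_itv a b measurable_sqr_increment) => z.
by rewrite lee_fin sqr_ge0.
Qed.

Let inner_ge0 (a b : R) y : (0 <= \int[mu]_(t in `[a, b]) sqr_increment (t, y))%E.
Proof. by apply: integral_ge0 => t _; rewrite lee_fin sqr_ge0. Qed.

(** Tonelli's theorem moves the expectation inside, first past [u] and then, for fixed [u], past
    [t]; the integrand becomes [sigma0^2 |t - u|]. *)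
Lemma integral_double_increment (a b : R) : 0 <= a -> a <= b -> b <= 1 ->
  (\int[P]_w \int[mu]_(u in `[a, b]) \int[mu]_(t in `[a, b])
     ((X t w - X u w) ^+ 2)%:E = (sigma0 ^+ 2 * ((b - a) ^+ 3 / 3))%:E)%E.
Proof.
move=> a0 ab b1.
have in01 x : x \in `[a, b]%classic -> 0 <= x <= 1.
  rewrite inE/= in_itv/= => /andP[ax xb].
  by rewrite (le_trans a0 ax) (le_trans xb b1).
etransitivity; first exact: (tonelli_itv a b (measurable_inner a b) (inner_ge0 a b) P).
transitivity (\int[mu]_(u in `[a, b])
  ((sigma0 ^+ 2)%:E * \int[mu]_(t in `[a, b]) `|t - u|%:E))%E.
  apply: eq_integral => u uab.
  have mf : measurable_fun [set: R * T]
      (fun z => ((X z.1 z.2 - X u z.2) ^+ 2)%:E).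
    apply/measurable_EFinP; apply: measurable_funX; apply: measurable_funB => //.
    apply: (measurableT_comp mX (g := fun z : R * T => (u, z.2))).
    by apply: measurable_fun_pair => //; exact: measurable_snd.
  have f0 z : (0 <= ((X z.1 z.2 - X u z.2) ^+ 2)%:E)%E by rewrite lee_fin sqr_ge0.
  etransitivity; first exact: (tonelli_itv a b mf f0 P).
  rewrite -ge0_integralZl_EFin ?sqr_ge0//; last first.
    apply/measurable_EFinP; apply: measurableT_comp => //.
    exact: measurable_funB.
  by apply: eq_integral => t tab; rewrite X_increment ?in01// EFinM.
rewrite ge0_integralZl_EFin ?sqr_ge0//.
- by rewrite integral_integral_abs_sub// EFinM.
- by move=> u _; apply: integral_ge0 => t _; rewrite lee_fin.
- apply: measurable_funTS.
  apply: (measurable_integral_itv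
    (f := fun z : R * R => `|z.1 - z.2|%:E)) => //.
  apply/measurable_EFinP; apply: measurableT_comp => //.
  exact: measurable_funB.
Qed.

(** Up to a nonzero constant the dispersion is the double integral of squared increments, measurable
    in [w] by Tonelli's theorem. *)
Lemma measurable_dispersion (a b : R) : 0 <= a -> a < b -> b <= 1 ->
  measurable_fun [set: T] (fun w => dispersion a b (X^~ w)).
Proof.
move=> a0 ab b1.
have := measurable_integral_itv a b (measurable_inner a b) (inner_ge0 a b).
rewrite [X in measurable_fun _ X](_ : _ =
    fun w => (2 * (b - a) * dispersion a b (X^~ w))%:E); last first.
  by apply/funext => w; rewrite -integral_sqr_sub_dispersion.
move/measurable_EFinP => mD.
rewrite [X in measurable_fun _ X](_ : _ = fun w =>
    (2 * (b - a))^-1 * (2 * (b - a) * dispersion a b (X^~ w))).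
  exact: measurable_funM.
apply/funext => w; rewrite mulKf//.
by rewrite mulf_neq0// ?pnatr_eq0// subr_eq0 gt_eqF.
Qed.

Lemma integral_dispersion (a b : R) : 0 <= a -> a < b -> b <= 1 ->
  P.-integrable [set: T] (fun w => (dispersion a b (X^~ w))%:E) /\
  (\int[P]_w (dispersion a b (X^~ w))%:E =
   (sigma0 ^+ 2 * (b - a) ^+ 2 / 6)%:E)%E.
Proof.
move=> a0 ab b1.
have c0 : 0 < 2 * (b - a) by rewrite mulr_gt0// subr_gt0.
have mD := measurable_dispersion a0 ab b1.
(* Nonnegativity, again from the double integral of squares, lets a finite expectation give
   integrability. *)
have D0 w : 0 <= dispersion a b (X^~ w).
  rewrite -(pmulr_rge0 _ c0) -lee_fin -integral_sqr_sub_dispersion//.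
  by apply: integral_ge0 => u _; apply: integral_ge0 => t _; rewrite lee_fin sqr_ge0.
have intD : (\int[P]_w (dispersion a b (X^~ w))%:E =
   (sigma0 ^+ 2 * (b - a) ^+ 2 / 6)%:E)%E.
  transitivity (\int[P]_w (((2 * (b - a))^-1)%:E * \int[mu]_(u in `[a, b])
      \int[mu]_(t in `[a, b]) ((X t w - X u w) ^+ 2)%:E))%E.
    apply: eq_integral => w _; rewrite integral_sqr_sub_dispersion// -EFinM.
    by rewrite mulKf// gt_eqF.
  rewrite ge0_integralZl_EFin ?invr_ge0 ?ltW//.
  - rewrite (integral_double_increment a0 (ltW ab) b1) -EFinM; congr EFin.
    by field; rewrite subr_eq0 gt_eqF.
  - by move=> w _; apply: integral_ge0 => u _; exact: (inner_ge0 a b (u, w)).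
  - exact: (measurable_integral_itv a b (measurable_inner a b) (inner_ge0 a b)).
split=> //; apply/integrableP; split; first exact/measurable_EFinP.
under eq_integral do rewrite /= ger0_norm//.
by rewrite intD ltry.
Qed.

(** Integrability is carried along with the value so that expectations can be subtracted. *)
Let mean (Y : T -> R) (m : R) :=
  P.-integrable [set: T] (EFin \o Y) /\ (\int[P]_w (Y w)%:E = m%:E)%E.

Let meanB (Y Z : T -> R) (m n : R) :
  mean Y m -> mean Z n -> mean (fun w => Y w - Z w) (m - n).
Proof.
move=> [iY mY] [iZ mZ]; split.
  exact: (@integrableB _ _ _ P _ measurableT _ _ iY iZ).
by rewrite integralB_EFin// mY mZ.
Qed.

Let mean_dispersion (a b : R) : 0 <= a -> a < b -> b <= 1 ->
  mean (fun w => dispersion a b (X^~ w)) (sigma0 ^+ 2 * (b - a) ^+ 2 / 6).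
Proof. exact: integral_dispersion. Qed.

Let coef_sqr (n : nat) (w : T) : R :=
  dispersion (haar_lo n) (haar_hi n) (X^~ w) -
  (dispersion (haar_lo n) (haar_mid n) (X^~ w) +
   dispersion (haar_mid n) (haar_hi n) (X^~ w)).

(** For a support of length [l = 2^-j] the three mean dispersions combine, up to the factor
    [sigma0^2], to [(l^2 - 2 (l / 2)^2) / 6 = l^2 / 12]. *)
Let mean_coef_sqr (n : nat) : (0 < n)%N ->
  mean (coef_sqr n) (sigma0 ^+ 2 * ((2 ^+ haar_level n)^-1 ^+ 2 / 12)).
Proof.
move=> n0.
have l0 := @haar_lo_ge0 R n; have h1 := @haar_hi_le1 R _ n0.
have lm := @haar_lo_lt_mid R n; have mh := @haar_mid_lt_hi R n.
have lh := lt_trans lm mh.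
have b1 : haar_mid n <= 1 :> R := le_trans (ltW mh) h1.
have a0 : 0 <= haar_mid n :> R := le_trans l0 (ltW lm).
have := meanB (meanB (mean_dispersion l0 lh h1) (mean_dispersion l0 lm b1))
  (mean_dispersion a0 mh h1).
under [X in mean X _ -> _]eq_fun do rewrite -addrA -opprD.
rewrite haar_hi_sub_lo haar_mid_sub_lo haar_hi_sub_mid.
by congr mean; move: (_^-1) => q; field.
Qed.

Lemma integral_haar_residual (M : nat) : (0 < M)%N ->
  (\int[P]_w sq_norm_L2 (fun t => X t w - haar_lin_approx M (X^~ w) t)%R =
   (sigma0 ^+ 2 *
     (1 / 6 - \sum_(1 <= n < M) (2 ^+ haar_level n)^-1 ^+ 2 / 12))%:E)%E.
Proof.
move=> M0; under eq_integral do rewrite sq_norm_haar_residual//.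
(* For [N >= 1], [F N] is the squared error with [N] retained terms; each further term removes one
   squared coefficient. *)
pose F N w := dispersion 0 1 (X^~ w) - \sum_(1 <= n < N) coef_sqr n w.
suff : mean (F M) (sigma0 ^+ 2 *
  (1 / 6 - \sum_(1 <= n < M) (2 ^+ haar_level n)^-1 ^+ 2 / 12)) by case.
elim: M M0 => // -[_ _|M IH _].
  have := mean_dispersion (lexx 0) ltr01 (lexx 1).
  rewrite (_ : F 1%N = fun w => dispersion 0 1 (X^~ w)); last first.
    by apply/funext => w; rewrite /F big_geq// subr0.
  by rewrite big_geq//; congr mean; field.
have := meanB (IH isT) (mean_coef_sqr (ltn0Sn M)).
rewrite (_ : F M.+2 = fun w => F M.+1 w - coef_sqr M.+1 w); last first.
  by apply/funext => w; rewrite /F [in LHS]big_nat_recr//= opprD addrA.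
by rewrite [in X in _ -> X]big_nat_recr//= -mulrBr opprD addrA.
Qed.

End mean_square_increments.

(** Within level [J] every further index subtracts the same [4^-J / 12], so the error is affine in
    [m]; the affine pieces of consecutive levels agree at powers of two. *)
Lemma haar_mse_closed_form (R : realType) (M : nat) : (0 < M)%N ->
  let J := trunc_log 2 M in let m := (M - 2 ^ J)%N in
  1 / 6 - \sum_(1 <= n < M) (2 ^+ haar_level n)^-1 ^+ 2 / 12 =
  1 / 12 * (1 / 2 ^+ J) * (2 - m%:R / 2 ^+ J) :> R.
Proof.
elim: M => // -[_ _|M IH _] /=.
  by rewrite big_geq// (_ : trunc_log 2 1 = 0%N)// expr0 expn0 subnn; field.
rewrite big_nat_recr//= opprD addrA IH// /haar_level.
set J := trunc_log 2 M.+1.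
have nz j : 2 ^+ j != 0 :> R by rewrite expf_eq0 pnatr_eq0 andbF.
have le : (2 ^ J <= M.+1)%N by exact: trunc_logP.
have : (M.+1 < 2 ^ J.+1)%N by exact: trunc_log_ltn.
(* If [M + 2 = 2^(J + 1)], the new index completes level [J]: [m] was [2^J - 1] and restarts at 0
   with level [J + 1]. *)
rewrite leq_eqVlt => /predU1P[eqM|lt].
  rewrite eqM trunc_expnK// subnn.
  have -> : (M.+1 - 2 ^ J)%:R = 2 ^+ J - 1 :> R.
    rewrite natrB// natrX (_ : M.+1%:R = 2 ^+ J.+1 - 1); last first.
      by rewrite -natrX -eqM -[M.+2%:R]natr1 addrK.
    by rewrite exprS; ring.
  by rewrite [2 ^+ J.+1]exprS; move: (2 ^+ J) (nz J) => q q0; field.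
have -> : trunc_log 2 M.+2 = J.
  by apply: trunc_log_eq => //; rewrite lt andbT ltnW.
by rewrite (subSn le) -[(M.+1 - _).+1%:R]natr1; move: (2 ^+ J) (nz J) => q q0; field.
Qed.

(** * Lévy processes *)

Section null_modification.
Context {d} {T : measurableType d} {R : realType}.
Variable m : {measure set T -> \bar R}.
Import HBNNSimple.

(** The integral of a nonnegative function is a supremum over simple functions below it. Setting
    such a function to 0 on [N] puts it below [g] and leaves its integral unchanged. *)
Let ge0_null_le_integral (f g : T -> \bar R) (N : set T) :
  measurable N -> m N = 0%E -> (forall x, (0 <= f x)%E) ->
  (forall x, (0 <= g x)%E) -> (forall x, ~ N x -> f x = g x) ->
  (\int[m]_x f x <= \int[m]_x g x)%E.
Proof.
move=> mN N0 f0 g0 fg; rewrite !ge0_integralTE//.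
apply/ge_ereal_sup => _ [h /= hf <-].
have mNC : measurable (~` N) by exact: measurableC.
apply: ereal_sup_ubound; exists (proj_nnsfun h mNC) => /=.
  move=> x; rewrite mindicE; have [|] := boolP (x \in ~` N).
    by rewrite inE => Nx; rewrite mulr1 -fg.
  by rewrite mulr0.
rewrite -!integralT_nnsfun; apply: ge0_ae_eq_integral => //.
- exact/measurable_EFinP.
- exact/measurable_EFinP.
- by move=> x _; rewrite lee_fin.
- by move=> x _; rewrite lee_fin.
- exists N; split => // x /= hx; apply: contrapT => Nx; apply: hx => _.
  by rewrite mindicE mem_set// mulr1.
Qed.

(* Neither [f] nor [g] is assumed measurable, because [w |-> sq_norm_L2 _] is
   arbitrary on the null event where the path is not square integrable. *)
Lemma ge0_null_eq_integral (f g : T -> \bar R) (N : set T) :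
  measurable N -> m N = 0%E -> (forall x, (0 <= f x)%E) ->
  (forall x, (0 <= g x)%E) -> (forall x, ~ N x -> f x = g x) ->
  (\int[m]_x f x = \int[m]_x g x)%E.
Proof.
move=> mN N0 f0 g0 fg; apply/eqP; rewrite eq_le.
rewrite (ge0_null_le_integral mN N0 f0 g0 fg)/=.
by apply: (ge0_null_le_integral mN N0 g0 f0) => x Nx; rewrite fg.
Qed.

End null_modification.

(** * Second moments of increments *)

Section levy_second_moments.
Context {d} {T : measurableType d} {R : realType}.
Variables (P : probability T R) (s : R -> {RV P >-> R}) (sigma0 : R).
Hypothesis s_levy : levy_process s.
Hypothesis s_var : zero_mean_variance s sigma0.

Lemma levy_second_moment (t : R) : 0 <= t ->
  (\int[P]_w ((s t w) ^+ 2)%:E = (sigma0 ^+ 2 * t)%:E)%E.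
Proof.
move=> t0; have [Et Vt] := s_var t0; rewrite -Vt.
rewrite /variance unlock Et/= unlock; apply: eq_integral => w _.
by rewrite -[RHS]/(((s t w - 0) * (s t w - 0))%:E) subr0 expr2.
Qed.

(** Stationarity says that two distributions agree on measurable sets, so nonnegative functions have
    the same integral against both. *)
Lemma levy_increment_law (t h : R) (f : R -> \bar R) : 0 <= t -> 0 <= h ->
  measurable_fun [set: R] f -> (forall x, (0 <= f x)%E) ->
  (\int[P]_w f (s (t + h)%R w - s t w)%R = \int[P]_w f (s h w - s 0 w)%R)%E.
Proof.
move=> t0 h0 mf f0.
pose Y : {RV P >-> R} := (s (t + h)%R \- s t)%R.
pose Z : {RV P >-> R} := (s h \- s 0)%R.
have eY := @ge0_integral_distribution _ _ _ _ _ P Y f mf f0.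
have eZ := @ge0_integral_distribution _ _ _ _ _ P Z f mf f0.
transitivity (\int[distribution P Y]_y f y)%E; first by rewrite eY.
transitivity (\int[distribution P Z]_y f y)%E; last by rewrite eZ.
apply: eq_measure_integral => B mB _.
exact: (levy_stationary s_levy t0 h0 mB).
Qed.

(** For [u <= t] stationarity replaces the increment by [s (t - u) - s 0], and [s 0] vanishes almost
    surely. *)
Lemma levy_increment_second_moment (t u : R) : 0 <= t -> 0 <= u ->
  (\int[P]_w ((s t w - s u w) ^+ 2)%:E = (sigma0 ^+ 2 * `|t - u|)%:E)%E.
Proof.
wlog tu : t u / u <= t.
  move=> H t0 u0; have [|/ltW ut] := leP u t; first by move=> ?; exact: H.
  rewrite distrC -H//; apply: eq_integral => w _; congr EFin; ring.
move=> t0 u0.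
have h0 : 0 <= t - u by rewrite subr_ge0.
have mf : measurable_fun [set: R] (fun x : R => (x ^+ 2)%:E).
  by apply/measurable_EFinP; exact: measurable_funX.
have sq0 (x : R) : (0 <= (x ^+ 2)%:E)%E by rewrite lee_fin sqr_ge0.
have := levy_increment_law u0 h0 mf sq0.
rewrite addrC subrK => ->; rewrite ger0_norm// -levy_second_moment//.
apply: ge0_ae_eq_integral => //.
- apply/measurable_EFinP; apply: measurable_funX.
  exact: measurable_funB.
- by apply/measurable_EFinP; apply: measurable_funX.
- have [N [mN N0 sN]] := levy_start s_levy.
  exists N; split => // w /= hw; apply: sN => /= s0; apply: hw => _.
  by rewrite s0 subr0.
Qed.

End levy_second_moments.

(** * A regular version and the transfer of the error *)

Section levy_regular_version.
Context {d} {T : measurableType d} {R : realType}.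
Variables (P : probability T R) (s : R -> {RV P >-> R}) (sigma0 : R).
Hypothesis s_levy : levy_process s.
Hypothesis s_var : zero_mean_variance s sigma0.
Hypothesis s_paths : measurable_paths s.
Notation mu := (@lebesgue_measure R).

(** The Haar identities are applied to every path, while [s] is regular only off a null event; the
    exceptional paths are replaced by 0. Paths are almost surely square integrable because their
    expected energy over [0, 1] is finite. *)
Lemma levy_L2_version : exists (X : R -> T -> R) (N : set T),
  [/\ measurable N, P N = 0%E,
      measurable_fun [set: R * T] (fun z : R * T => X z.1 z.2),
      (forall w, square_integrable mu `[0, 1] (X^~ w)) &
      forall t w, 0 <= t <= 1 -> ~ N w -> X t w = s t w].
Proof.
have [A [mA PA] ms] := s_paths.
have m01A : measurable ((`[0, 1] : set R) `*` A).
  by apply: measurableX => //; exact: measurable_itv.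
pose Y : R * T -> R := (fun z : R * T => s z.1 z.2) \_ ((`[0, 1] : set R) `*` A).
have mY : measurable_fun [set: R * T] Y by exact: (measurable_restrictT _ m01A).1 ms.
have YE t w : 0 <= t <= 1 -> A w -> Y (t, w) = s t w.
  by move=> t01 Aw; rewrite /Y patchE mem_set//; split => //=; rewrite in_itv.
have mY2 : measurable_fun [set: R * T] (fun z => (Y z ^+ 2)%:E).
  by apply/measurable_EFinP; exact: measurable_funX.
have Y20 z : (0 <= (Y z ^+ 2)%:E)%E by rewrite lee_fin sqr_ge0.
pose energy w : \bar R := (\int[mu]_(t in `[0%R, 1%R]) (Y (t, w) ^+ 2)%:E)%E.
have menergy : measurable_fun [set: T] energy.
  exact: (measurable_integral_itv 0 1 mY2 Y20).
have energy0 w : (0 <= energy w)%E by exact: integral_ge0.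
(* Only finiteness matters, so [sigma0^2 t] is bounded crudely by [sigma0^2]. *)
have ienergy : (\int[P]_w energy w <= (sigma0 ^+ 2)%:E)%E.
  rewrite /energy; rewrite [leLHS](tonelli_itv 0 1 mY2 Y20 P).
  apply: (@le_trans _ _ (\int[mu]_(t in `[0%R, 1%R]) (sigma0 ^+ 2)%:E)%E).
    apply: ge0_le_integral => //.
    - by move=> t _; exact: integral_ge0.
    - apply: measurable_funTS.
      exact: (measurable_fun_fubini_tonelli_F (m2 := P) _ mY2 Y20).
    move=> t /=; rewrite in_itv/= => /andP[t0 t1].
    rewrite (@le_trans _ _ (\int[P]_w ((s t w) ^+ 2)%:E)%E)//.
      apply: ge0_le_integral => //.
      - apply/measurable_EFinP; apply: measurable_funX.
        exact: (measurable_fun_pair2 t mY).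
      - by apply/measurable_EFinP; apply: measurable_funX.
      - move=> w _; rewrite lee_fin /Y patchE; case: ifP => //= _.
        by rewrite expr0n sqr_ge0.
    by rewrite (levy_second_moment s_var t0) lee_fin ler_piMr// sqr_ge0.
  by rewrite integral_cst//= lebesgue_measure_itv/= lte01 oppr0 adde0 mule1.
have fin_energy : P.-integrable [set: T] energy.
  apply/integrableP; split => //.
  under eq_integral do rewrite gee0_abs//.
  exact: le_lt_trans ienergy (ltry _).
(* On [B] the path is measurable over [0, 1] and has finite energy; [X] vanishes off [B]. *)
pose B : set T := A `&` [set w | energy w \is a fin_num].
have mF : measurable [set w | energy w \is a fin_num].
  by rewrite -[X in measurable X]setTI; exact: emeasurable_fin_num.
have mB : measurable B by exact: measurableI.
have mAC := measurableC mA; have mFC := measurableC mF.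
have PAC : P (~` A) = 0%E by rewrite probability_setC// PA subee.
have PFC : P (~` [set w | energy w \is a fin_num]) = 0%E.
  have [N [mN N0 sN]] := integrable_ae measurableT fin_energy.
  apply: (subset_measure0 mFC mN _ N0) => w /= nw.
  by apply: sN => /= h; apply: nw; exact: h.
have PB : P (~` B) = 0%E.
  rewrite /B setCI; apply/eqP; rewrite eq_le measure_ge0 andbT.
  apply: le_trans (measureU2 P mAC mFC) _.
  by rewrite -[leRHS]adde0 leeD//= ?PAC ?PFC.
pose X t w : R := Y (t, w) * \1_B w.
exists X, (~` B); split => //.
- exact: measurableC.
- apply: measurable_funM.
    exact: mY.
  apply: (measurableT_comp (measurable_indic mB)); exact: measurable_snd.
- move=> w; have [Bw|nBw] := pselect (B w); last first.
    rewrite [X in square_integrable _ _ X](_ : _ = cst 0); last first.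
      by apply/funext => t; rewrite /X indicE memNset// mulr0.
    exact: square_integrable_cst.
  rewrite [X in square_integrable _ _ X](_ : _ = fun t => Y (t, w)); last first.
    by apply/funext => t; rewrite /X indicE mem_set// mulr1.
  have mYw : measurable_fun [set: R] (fun t => Y (t, w)).
    exact: (measurable_fun_pair1 w mY).
  split; first exact: measurable_funTS.
  apply/integrableP; split.
    by apply/measurable_EFinP; apply: measurable_funX; exact: measurable_funTS.
  under eq_integral do rewrite gee0_abs ?lee_fin ?sqr_ge0//.
  by case: Bw => _ /=; rewrite ge0_fin_numE.
- move=> t w t01 /contrapT Bw.
  by rewrite /X YE//; [rewrite indicE mem_set// mulr1|case: Bw].
Qed.

(** Off [N] the version and [s] agree on [0, 1], hence so do their Haar coefficients and squared
    errors; a null event does not change the expectations. *)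
Lemma haar_mse (M : nat) : (0 < M)%N ->
  (mse_lin s M = (sigma0 ^+ 2 *
     (1 / 6 - \sum_(1 <= n < M) (2 ^+ haar_level n)^-1 ^+ 2 / 12))%:E)%E.
Proof.
move=> M0; have [X [N [mN N0 mX X_L2 XE]]] := levy_L2_version.
rewrite -(integral_haar_residual mX X_L2 (P := P) _ M0); last first.
  move=> t u t01 u01; have /andP[t0 _] := t01; have /andP[u0 _] := u01.
  rewrite -(levy_increment_second_moment s_levy s_var t0 u0).
  apply: (ge0_null_eq_integral mN N0) => w; rewrite ?lee_fin ?sqr_ge0//.
  by move=> Nw; rewrite !XE.
apply: (ge0_null_eq_integral mN N0) => w.
- by apply: integral_ge0 => t _; rewrite lee_fin sqr_ge0.
- by apply: integral_ge0 => t _; rewrite lee_fin sqr_ge0.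
move=> Nw; apply: eq_integral => t; rewrite inE/= => t01.
rewrite XE// /haar_lin_approx; congr ((_ - _) ^+ 2)%:E.
apply: eq_bigr => n _; congr (_ * _).
by apply: eq_Rintegral => u; rewrite inE/= => u01; rewrite XE.
Qed.

End levy_regular_version.

Theorem proposition2 (R : realType) (d : measure_display)
    (T : measurableType d) (P : probability T R)
    (s : R -> {RV P >-> R}) (sigma0 : R)
    (s_levy : levy_process s)
    (s_var : zero_mean_variance s sigma0)
    (s_paths : measurable_paths s) :
  (forall M : nat, (1 <= M)%N ->
     let J := trunc_log 2 M in
     let m := (M - 2 ^ J)%N in
     [/\ (2 ^ J <= M)%N, (m <= 2 ^ J - 1)%N &
         mse_lin s M =
         (sigma0 ^+ 2 / 12 * (1 / 2 ^+ J) * (2 - m%:R / 2 ^+ J))%:E]) /\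
  (forall i : nat,
     let M := (2 ^ i)%N in mse_lin s M = (sigma0 ^+ 2 / (6 * M%:R))%:E).
Proof.
have mse M : (0 < M)%N -> mse_lin s M =
    (sigma0 ^+ 2 / 12 * (1 / 2 ^+ trunc_log 2 M) *
     (2 - (M - 2 ^ trunc_log 2 M)%:R / 2 ^+ trunc_log 2 M))%:E.
  move=> M0; rewrite (haar_mse s_levy s_var s_paths)// haar_mse_closed_form//.
  by congr EFin; rewrite !mulrA !mulr1.
split=> [M M0 J m|i M].
  split; [exact: trunc_logP| |exact: mse].
  by rewrite -ltnS subn1 prednK ?expn_gt0//; exact: haar_shift_lt.
(* For [M = 2^i] one has [J = i] and [m = 0]. *)
rewrite mse ?expn_gt0// /M trunc_expnK// subnn natrX.
have : 2 ^+ i != 0 :> R by rewrite expf_eq0 pnatr_eq0 andbF.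
by rewrite mulr0n mul0r subr0; move: (2 ^+ i) => q q0; congr EFin; field.
Qed.
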